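(* No online algorithm for the generalized precedence-constrained scheduling (GPS) problem has a sub-polynomial competitive ratio; this holds even when restricted to instances in which all processing functions are equal to one fixed power function $p(z)=z^{\gamma}$.
   Context: The GPS problem: the input is a directed acyclic graph $G=(J,E)$ whose vertices are jobs, each job $j\in J$ having a size $s_j>0$; a number $m$ of identical machines; and for each job $j$ a non-decreasing concave processing function $p_j:[0,m]\to\mathbb{R}_{\ge 0}$ with $p_j(0)=0$. A schedule is a family of functions $A_t:J\to[0,m]$, $t\in(0,\infty)$, where $A_t(j)$ is the (possibly fractional) number of machines allocated to job $j$ at time $t$; preemption is allowed. It must satisfy $\sum_{j}A_t(j)\le m$ for all $t$, and for every arc $(j_1,j_2)\in E$ and every $t$, if $A_t(j_2)>0$ then $\int_0^t p_{j_1}(A_{t'}(j_1))\,dt'\ge s_{j_1}$; every job must be completed. The makespan is $\sup\{t:\sum_{j}A_t(j)>0\}$, to be minimized. A job is available at time $t$ if all its predecessors in $G$ have been completely processed by time $t$. An online algorithm is one that operates on instances where each job (with its size, processing function and outgoing precedence information) is revealed only at the moment it becomes available, and must make its allocation decisions at each time without knowledge of unrevealed jobs. Its competitive ratio is the supremum over instances of the ratio of its makespan to the optimal (offline) makespan; ''sub-polynomial'' means growing slower than any polynomial in the instance size. *)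

(* Defs.v *)
From HB Require Import structures.
From mathcomp Require Import all_boot all_order all_algebra.
From mathcomp Require Import all_classical all_reals all_analysis.
Set Implicit Arguments. Unset Strict Implicit. Unset Printing Implicit Defensive.
Import Order.TTheory GRing.Theory Num.Theory.
Import numFieldNormedType.Exports.
Local Open Scope classical_set_scope.
Local Open Scope ring_scope.

(* Job names are natural numbers (a countable universe of labels), so  *)
(* that an online algorithm is not told the number of jobs in advance. *)

Section GPS.
Context {R : realType}.

Record instance := Instance {
  inst_m : nat;           (* number of identical machines *)
  inst_J : seq nat;       (* the (finite) set of jobs *)
  inst_E : rel nat;       (* precedence arcs (j1, j2) *)
  inst_s : nat -> R       (* job sizes *)
}.

Definition has_cycle (E : rel nat) : Prop :=
  exists (j : nat) (p : seq nat), p != [::] /\ path E j p /\ last j p = j.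

Definition wf_instance (I : instance) : Prop :=
  [/\ (0 < inst_m I)%N,
      uniq (inst_J I),
      (forall i j, inst_E I i j -> i \in inst_J I /\ j \in inst_J I),
      ~ has_cycle (inst_E I)
    & (forall j, j \in inst_J I -> 0 < inst_s I j)].

(* a schedule: S t j = (fractional) number of machines given to job j at time t *)
Definition schedule := R -> nat -> R.

Definition pw (gamma : R) (z : R) : R := z `^ gamma.

Definition processed (gamma : R) (S : schedule) (j : nat) (t : R) : \bar R :=
  (\int[lebesgue_measure]_(x in `]0%R, t]%classic) (pw gamma (S x j))%:E)%E.

Definition processed_total (gamma : R) (S : schedule) (j : nat) : \bar R :=
  (\int[lebesgue_measure]_(x in `]0%R, +oo[%classic) (pw gamma (S x j))%:E)%E.

Definition feasible (gamma : R) (I : instance) (S : schedule) : Prop :=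
  [/\ (* measurability, needed for the integrals to make sense *)
      (forall j, measurable_fun setT (fun t => S t j)),
      (forall t j, 0 < t -> (0 <= S t j)%R /\ (S t j <= (inst_m I)%:R)%R),
      (forall t j, 0 < t -> j \notin inst_J I -> S t j = 0) /\
      (forall t, 0 < t -> (\sum_(j <- inst_J I) S t j)%R <= (inst_m I)%:R),
      (forall j1 j2 t, inst_E I j1 j2 -> 0 < t -> 0 < S t j2 ->
           ((inst_s I j1)%:E <= processed gamma S j1 t)%E)
    &
      (forall j, j \in inst_J I -> ((inst_s I j)%:E <= processed_total gamma S j)%E)].

Definition makespan (I : instance) (S : schedule) : \bar R :=
  ereal_sup [set t%:E | t in [set t : R | 0 < t /\ 0 < \sum_(j <- inst_J I) S t j]].

Definition opt_makespan (gamma : R) (I : instance) : \bar R :=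
  ereal_inf [set makespan I S | S in [set S | feasible gamma I S]].

Definition available (gamma : R) (I : instance) (S : schedule) (t : R) (j : nat) : Prop :=
  j \in inst_J I /\
  forall i, inst_E I i j -> ((inst_s I i)%:E <= processed gamma S i t)%E.

(* A (deterministic) online algorithm maps each instance to a schedule,
   such that the schedule is feasible and non-anticipative: if I' reveals,
   along the run of the algorithm on I, exactly the same information as I
   up to time t (same machines, same set of available jobs at every time
   t' in [0, t], and same size and outgoing arcs of every job revealed by
   time t), then the algorithm behaves identically on I and I' on (0, t]. *)
Definition online_algorithm (gamma : R) (ALG : instance -> schedule) : Prop :=
  (forall I, wf_instance I -> feasible gamma I (ALG I)) /\
  (forall I I' (t : R), wf_instance I -> wf_instance I' -> 0 <= t ->
     inst_m I = inst_m I' ->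
     (forall t' j, 0 <= t' <= t ->
        available gamma I (ALG I) t' j <-> available gamma I' (ALG I) t' j) ->
     (forall j, available gamma I (ALG I) t j ->
        inst_s I j = inst_s I' j /\ (forall k, inst_E I j k = inst_E I' j k)) ->
     forall t' j, 0 < t' <= t -> ALG I t' j = ALG I' t' j).

End GPS.

(* Main.v *)
(* Take p(z) = sqrt z, one machine and unit jobs, in k = q^2 layers of k jobs A,
   each followed by one job B. Exactly one B of a layer (the hub) precedes all
   the jobs A of the next layer. The arcs out of a B are revealed only once its
   A is finished, so the adversary may take as hub the successor of an A that
   the algorithm leaves unfinished. By concavity k jobs run in parallel are
   processed at total speed at most sqrt k = q, hence every layer costs the
   algorithm time at least q / 2. Offline, one runs the 2k jobs of the hub path
   first, one per unit of time, then all the A in parallel and all the B in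
   parallel, in total time 6k. The ratio is of order q, with 2 q^4 jobs. *)

Require Import Defs.
From HB Require Import structures.
From mathcomp Require Import all_boot all_order all_algebra.
From mathcomp Require Import all_classical all_reals all_analysis.
From mathcomp Require Import measurable_realfun.
From mathcomp Require Import zify ring lra.

Set Implicit Arguments. Unset Strict Implicit. Unset Printing Implicit Defensive.
Import Order.TTheory GRing.Theory Num.Theory.
Local Open Scope ring_scope.

(** * Work processed by a schedule *)

Lemma measurable_speed {R : realType} (gamma : R) (S : @schedule R) (j : nat)
    (D : set R) :
  measurable_fun setT (fun t => S t j) ->
  measurable_fun D (fun x => (pw gamma (S x j))%:E).
Proof.
move=> mS; apply/measurable_EFinP; apply: (@measurable_funS _ _ _ _ setT) => //.
exact: (measurableT_comp (measurable_powR gamma) mS).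
Qed.

Lemma speed_ge0 {R : realType} (gamma : R) (S : @schedule R) (j : nat) (x : R) :
  (0 <= (pw gamma (S x j))%:E)%E.
Proof. by rewrite lee_fin powR_ge0. Qed.

Lemma subset_Ioc {R : realType} (u v t : R) :
  0 <= u -> v <= t -> (`]u, v]%classic `<=` `]0%R, t]%classic)%classic.
Proof.
move=> u0 vt x /=; rewrite !in_itv /= => /andP[ux xv].
by rewrite (le_lt_trans u0 ux) (le_trans xv vt).
Qed.

Lemma processed_mono {R : realType} (gamma : R) (S : @schedule R) (j : nat)
    (t t' : R) :
  measurable_fun setT (fun t => S t j) -> t <= t' ->
  (processed gamma S j t <= processed gamma S j t')%E.
Proof.
move=> mS tt'; apply: ge0_subset_integral => //.
- exact: measurable_speed.
- by move=> x _; exact: speed_ge0.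
- exact: subset_Ioc.
Qed.

Lemma processed_le_total {R : realType} (gamma : R) (S : @schedule R) (j : nat)
    (t : R) :
  measurable_fun setT (fun t => S t j) ->
  (processed gamma S j t <= processed_total gamma S j)%E.
Proof.
move=> mS; apply: ge0_subset_integral => //.
- exact: measurable_speed.
- by move=> x _; exact: speed_ge0.
- by move=> x /=; rewrite !in_itv /= => /andP[-> _].
Qed.

(** Positivity of [gamma] excludes the convention that 0 to the power 0 is 1, under which idle jobs
    would progress. *)
Lemma processed_idle {R : realType} (gamma : R) (S : @schedule R) (j : nat)
    (t : R) :
  0 < gamma -> (forall x, 0 < x <= t -> S x j = 0) ->
  processed gamma S j t = 0%E.
Proof.
move=> g0 S0; apply: integral0_eq => x /=; rewrite in_itv /= => xt.
by rewrite S0 // /pw powR0 ?gt_eqF.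
Qed.

Lemma processed_ge {R : realType} (gamma : R) (S : @schedule R) (j : nat)
    (c u v t : R) :
  0 <= gamma -> measurable_fun setT (fun t => S t j) -> 0 <= c ->
  0 <= u -> u <= v -> v <= t -> (forall x, u < x <= v -> c <= S x j) ->
  ((pw gamma c * (v - u))%:E <= processed gamma S j t)%E.
Proof.
move=> g0 mS c0 u0 uv vt cS.
apply: (@le_trans _ _ (\int[lebesgue_measure]_(x in `]u, v]%classic)
    (pw gamma (S x j))%:E)%E); last first.
  apply: ge0_subset_integral => //.
  - exact: measurable_speed.
  - by move=> x _; exact: speed_ge0.
  - exact: subset_Ioc.
have -> : (pw gamma c * (v - u))%:E =
    (\int[lebesgue_measure]_(x in `]u, v]%classic) cst (pw gamma c)%:E x)%E.
  rewrite integral_cst //= lebesgue_measure_itv /= lte_fin.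
  case: ltP => [//|vu].
  by rewrite (le_anti (introT andP (conj uv vu))) subrr mulr0 mule0.
apply: ge0_le_integral => //.
- by move=> x _; rewrite lee_fin powR_ge0.
- exact: measurable_speed.
- move=> x /=; rewrite in_itv /= => xuv; rewrite lee_fin.
  by apply: ge0_ler_powR; rewrite ?nnegrE // ?cS // (le_trans c0) ?cS.
Qed.

Lemma processed_total_gt0 {R : realType} (gamma : R) (S : @schedule R)
    (j : nat) :
  0 < gamma -> (0 < processed_total gamma S j)%E ->
  exists2 t : R, 0 < t & S t j != 0.
Proof.
move=> g0 ST; apply: contrapT => noS; move: ST.
rewrite /processed_total integral0_eq ?ltxx // => x /=.
rewrite in_itv /= andbT => x0.
have [->|Sx] := eqVneq (S x j) 0; first by rewrite /pw powR0 ?gt_eqF.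
by case: noS; exists x.
Qed.

(** * Total speed of q^2 jobs sharing one machine *)

(* AM-GM: sqrt x <= (q x + 1/q) / 2. *)
Lemma sum_sqrt_le {R : realType} (q : nat) (F : nat -> R) :
  (0 < q)%N -> (forall j, 0 <= F j) -> \sum_(0 <= j < q * q) F j <= 1 ->
  \sum_(0 <= j < q * q) pw 2^-1 (F j) <= q%:R.
Proof.
move=> q0 F0 F1; have qR : 0 < q%:R :> R by rewrite ltr0n.
apply: (@le_trans _ _ (\sum_(0 <= j < q * q) (q%:R / 2 * F j + (2 * q%:R)^-1))).
  apply: ler_sum => j _; rewrite /pw powR12_sqrt //.
  set s := Num.sqrt _; have -> : F j = s ^+ 2 by rewrite sqr_sqrtr.
  rewrite -subr_ge0.
  have -> : q%:R / 2 * s ^+ 2 + (2 * q%:R)^-1 - s = (q%:R * s - 1) ^+ 2 / (2 * q%:R).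
    by field; rewrite gt_eqF.
  by rewrite divr_ge0 ?sqr_ge0 // mulr_ge0 // ltW.
rewrite big_split /= -mulr_sumr sumr_const_nat subn0 -[X in _ + X]mulr_natr natrM.
have -> : (2 * q%:R)^-1 * (q%:R * q%:R) = q%:R / 2 :> R.
  by field; rewrite gt_eqF.
have : q%:R / 2 * \sum_(0 <= j < q * q) F j <= q%:R / 2 * 1.
  by rewrite ler_wpM2l // divr_ge0.
lra.
Qed.

(** The total speed is at most [q] times the indicator of []tau, t]]: the square root bound applies
    after [tau], idleness before it. Integration then gives the estimate. *)
Lemma sum_processed_le {R : realType} (q : nat) (S : @schedule R)
    (job : nat -> nat) (tau t : R) :
  (0 < q)%N -> 0 <= tau -> tau <= t ->
  (forall j, measurable_fun setT (fun t => S t j)) ->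
  (forall x j, 0 < x -> 0 <= S x j) ->
  (forall x, 0 < x -> \sum_(0 <= j < q * q) S x (job j) <= 1) ->
  (forall x j, (j < q * q)%N -> 0 < x <= tau -> S x (job j) = 0) ->
  (\sum_(0 <= j < q * q) processed 2^-1 S (job j) t <= (q%:R * (t - tau))%:E)%E.
Proof.
move=> q0 tau0 taut mS S0 S1 Sidle.
rewrite -ge0_integral_sum //=; last 2 first.
- by move=> j; exact: measurable_speed.
- by move=> j x _; exact: speed_ge0.
apply: (@le_trans _ _ (\int[lebesgue_measure]_(x in `]0%R, t]%classic)
    (q%:R%:E * (\1_(`]tau, t]%classic : set R) x)%:E))%E).
  apply: ge0_le_integral => //.
  - by move=> x _; apply: sume_ge0 => j _; exact: speed_ge0.
  - by apply: emeasurable_sum => j; exact: measurable_speed.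
  - apply: emeasurable_funM => //; apply/measurable_EFinP.
    by apply: (@measurable_funS _ _ _ _ setT) => //; exact: measurable_indic.
  move=> x /=; rewrite in_itv /= => /andP[x0 xt].
  rewrite sumEFin -EFinM lee_fin indicE.
  have [taux|xtau] := ltP tau x.
    rewrite mem_set ?mulr1 /= ?in_itv /= ?taux //.
    have -> : \sum_(0 <= i < q * q) pw 2^-1 (S x (job i)) =
              \sum_(0 <= i < q * q) pw 2^-1 ((fun j => S x (job j)) i) by [].
    by apply: sum_sqrt_le => //; [move=> j; exact: S0 | exact: S1].
  rewrite memNset ?mulr0 /= ?in_itv /= ?ltNge ?xtau //.
  rewrite big_nat_cond big1 // => j /andP[/andP[_ jk] _].
  by rewrite Sidle ?x0 // /pw powR0 // gt_eqF.
rewrite ge0_integralZl_EFin //.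
2: apply/measurable_EFinP.
2: by apply: (@measurable_funS _ _ _ _ setT) => //; exact: measurable_indic.
rewrite integral_indic //= setIidl; last exact: subset_Ioc.
rewrite lebesgue_measure_itv /= lte_fin.
case: ltP => [_|_]; first by rewrite -EFinB -EFinM.
by rewrite mule0 lee_fin mulr_ge0 // subr_ge0.
Qed.

(** * Piecewise constant schedules *)

(** The half-open phases are disjoint when [u] is nondecreasing, so at any time at most one
    allocation [w p] is in force. *)
Definition phased {R : realType} (u : nat -> R) (w : nat -> nat -> R) (n : nat) :
    @schedule R :=
  fun t j => \sum_(0 <= p < n) w p j * (u p < t <= u p.+1)%R%:R.

Lemma phased_ge0 {R : realType} (u : nat -> R) (w : nat -> nat -> R) (n : nat)
    (t : R) (j : nat) :
  (forall p j, 0 <= w p j) -> 0 <= phased u w n t j.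
Proof. by move=> w0; apply: sumr_ge0 => p _; rewrite mulr_ge0. Qed.

Lemma phased_ge {R : realType} (u : nat -> R) (w : nat -> nat -> R) (n p : nat)
    (t : R) (j : nat) :
  (forall p j, 0 <= w p j) -> (p < n)%N -> u p < t <= u p.+1 ->
  w p j <= phased u w n t j.
Proof.
move=> w0 pn upt; rewrite /phased big_mkord (bigD1 (Ordinal pn)) //= upt mulr1.
by rewrite lerDl sumr_ge0 // => i _; rewrite mulr_ge0.
Qed.

Lemma phased_gt0 {R : realType} (u : nat -> R) (w : nat -> nat -> R) (n : nat)
    (t : R) (j : nat) :
  (forall p j, 0 <= w p j) -> 0 < phased u w n t j ->
  exists p, [/\ (p < n)%N, 0 < w p j & u p < t <= u p.+1].
Proof.
move=> w0 /lt0r_neq0; rewrite /phased psumr_neq0 => [|p _]; last by rewrite mulr_ge0.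
case/hasP => p; rewrite mem_index_iota /= => pn.
case: (u p < t <= u p.+1) / boolP => [upt|_]; last by rewrite mulr0 ltxx.
by rewrite mulr1 => wp; exists p.
Qed.

Lemma phased_measurable {R : realType} (u : nat -> R) (w : nat -> nat -> R)
    (n j : nat) :
  measurable_fun setT (fun t => phased u w n t j).
Proof.
apply: measurable_sum => p; apply: measurable_funM => //.
rewrite (_ : (fun _ => _) = \1_(`]u p, u p.+1]%classic : set R)).
  exact: measurable_indic.
apply/funext => t; rewrite indicE; congr (_%:R).
by rewrite mem_setE in_itv.
Qed.

Lemma phased_sum_le {R : realType} (u : nat -> R) (w : nat -> nat -> R)
    (n : nat) (J : seq nat) (m t : R) :
  (forall p, u p <= u p.+1) -> 0 <= m ->
  (forall p, (p < n)%N -> \sum_(j <- J) w p j <= m) ->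
  \sum_(j <- J) phased u w n t j <= m.
Proof.
move=> uS m0 wm; rewrite exchange_big /=.
apply: (@le_trans _ _ (\sum_(0 <= p < n) m * (u p < t <= u p.+1)%R%:R)).
  rewrite !big_mkord; apply: ler_sum => p _.
  by rewrite -mulr_suml ler_wpM2r // wm.
rewrite -mulr_sumr -[leRHS]mulr1 ler_wpM2l //.
(* The indicator of a phase is the difference of the indicators of [u p < t] and [u p.+1 < t], so
   the sum telescopes to at most 1. *)
apply: (@le_trans _ _ (\sum_(0 <= p < n) (- (u p.+1 < t)%R%:R - - (u p < t)%R%:R))).
  apply: ler_sum => p _; have := uS p.
  case: (ltP (u p) t); case: (ltP (u p.+1) t); rewrite /= => h1 h2 h3; lra.
by rewrite telescope_sumr //; case: (_ < _); case: (_ < _) => /=; lra.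
Qed.

(** Reduces feasibility to a check on phases: some single phase completes each job, and whatever
    runs in a phase has each predecessor completed within one earlier phase. *)
Lemma phased_feasible {R : realType} (gamma : R) (I : @instance R)
    (u : nat -> R) (w : nat -> nat -> R) (n : nat) :
  let finishes p j :=
    inst_s I j <= pw gamma (w p j) * (u p.+1 - u p) in
  0 <= gamma -> u 0%N = 0 -> (forall p, u p <= u p.+1) ->
  (forall p j, 0 <= w p j) ->
  (forall p j, j \notin inst_J I -> w p j = 0) ->
  (forall p, (p < n)%N -> \sum_(j <- inst_J I) w p j <= (inst_m I)%:R) ->
  (forall i j p, inst_E I i j -> (p < n)%N -> 0 < w p j ->
     exists2 p', (p' < p)%N & finishes p' i) ->
  (forall j, j \in inst_J I -> exists2 p, (p < n)%N & finishes p j) ->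
  feasible gamma I (phased u w n).
Proof.
move=> finishes g0 u0 uS w0 wJ wm wE wfin.
have u_mono : {homo u : i j / (i <= j)%N >-> i <= j}.
  by apply: homo_leq => // x y z; exact: le_trans.
have u_ge0 p : 0 <= u p by rewrite -u0 u_mono.
have sum_le t : \sum_(j <- inst_J I) phased u w n t j <= (inst_m I)%:R.
  exact: phased_sum_le.
have offJ t j : j \notin inst_J I -> phased u w n t j = 0.
  by move=> jJ; rewrite /phased big1 // => p _; rewrite wJ // mul0r.
have processed_fin p j t : (p < n)%N -> finishes p j -> u p.+1 <= t ->
    ((inst_s I j)%:E <= processed gamma (phased u w n) j t)%E.
  move=> pn pj upt.
  apply: (@le_trans _ _ (pw gamma (w p j) * (u p.+1 - u p))%:E).
    by rewrite lee_fin.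
  apply: processed_ge => //; first exact: phased_measurable.
  by move=> x ux; exact: phased_ge.
split=> //.
- by move=> j; exact: phased_measurable.
- move=> t j t0; split; first exact: phased_ge0.
  have [jJ|jJ] := boolP (j \in inst_J I); last by rewrite offJ.
  apply: le_trans (sum_le t); rewrite (big_rem j) //= lerDl.
  by apply: sumr_ge0 => i _; exact: phased_ge0.
- by split=> [t j _|t _]; [exact: offJ | exact: sum_le].
- move=> i j t Eij t0 /(phased_gt0 w0)[p [pn wp /andP[upt _]]].
  have [p' p'p fin] := wE _ _ _ Eij pn wp.
  apply: (processed_fin p') => //; first exact: ltn_trans pn.
  by apply: le_trans (ltW upt); exact: u_mono.
- move=> j /wfin[p pn fin].
  apply: le_trans (processed_le_total _ (u p.+1) (phased_measurable u w n j)).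
  exact: processed_fin fin _.
Qed.

Lemma phased_makespan {R : realType} (I : @instance R)
    (u : nat -> R) (w : nat -> nat -> R) (n : nat) :
  (forall p, u p <= u p.+1) -> (forall p j, 0 <= w p j) ->
  (makespan I (phased u w n) <= (u n)%:E)%E.
Proof.
move=> uS w0; apply: ge_ereal_sup => _ [t [_ t0] <-]; rewrite lee_fin.
have u_mono : {homo u : i j / (i <= j)%N >-> i <= j}.
  by apply: homo_leq => // x y z; exact: le_trans.
move: t0 => /lt0r_neq0; rewrite psumr_neq0 => [|j _]; last exact: phased_ge0.
case/hasP => j _ /= /(phased_gt0 w0)[p [pn _ /andP[_ tu]]].
exact: le_trans tu (u_mono _ _ pn).
Qed.

(** * The layered instance *)

(** Each layer is a block of [k + k] consecutive labels, jobs A first, so division by [k + k]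
    recovers layer and kind. *)
Definition jobA (k l j : nat) : nat := (l * (k + k) + j)%N.
Definition jobB (k l j : nat) : nat := (l * (k + k) + (k + j))%N.

(* The arcs are jobA l j -> jobB l j and jobB l (f l) -> jobA l.+1 j, so the
   hub of layer l is the pair of jobs of index f l. *)
Definition arc (k : nat) (f : nat -> nat) (x y : nat) : bool :=
  let l := (y %/ (k + k))%N in
  if (y %% (k + k) < k)%N then (0 < l)%N && (x == jobB k l.-1 (f l.-1))
  else x == (y - k)%N.

(** The hub of the last layer has no outgoing arc, so its index is still free for the adversary. *)
Definition tree {R : realType} (k : nat) (f : nat -> nat) (L : nat) :
    @instance R :=
  Instance 1 (iota 0 (L * (k + k)))
    (fun x y => (y < L * (k + k))%N && arc k f x y) (fun=> 1).

Lemma arc_jobA (k : nat) (f : nat -> nat) (x l j : nat) :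
  (j < k)%N ->
  arc k f x (jobA k l j) = (0 < l)%N && (x == jobB k l.-1 (f l.-1)).
Proof.
move=> jk; have jkk : (j < k + k)%N by lia.
rewrite /arc /jobA modnMDl divnMDl; last by lia.
by rewrite modn_small // divn_small // jk addn0.
Qed.

Lemma arc_jobB (k : nat) (f : nat -> nat) (x l j : nat) :
  (j < k)%N -> arc k f x (jobB k l j) = (x == jobA k l j).
Proof.
move=> jk; have jkk : (k + j < k + k)%N by lia.
rewrite /arc /jobB modnMDl modn_small // ltnNge leq_addr /=.
by congr (_ == _); rewrite /jobA; lia.
Qed.

Lemma jobA_lt (k L l j : nat) :
  (j < k)%N -> (jobA k l j < L * (k + k))%N = (l < L)%N.
Proof.
move=> jk; rewrite -ltn_divLR; last by lia.
by rewrite /jobA divnMDl ?divn_small ?addn0 //; lia.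
Qed.

Lemma jobB_lt (k L l j : nat) :
  (j < k)%N -> (jobB k l j < L * (k + k))%N = (l < L)%N.
Proof.
move=> jk; rewrite -ltn_divLR; last by lia.
by rewrite /jobB divnMDl ?divn_small ?addn0 //; lia.
Qed.

Lemma job_split (k y : nat) :
  (0 < k)%N ->
  exists l j, (j < k)%N /\ (y = jobA k l j \/ y = jobB k l j).
Proof.
move=> k0; exists (y %/ (k + k))%N.
have yE := divn_eq y (k + k).
have : (y %% (k + k) < k + k)%N by rewrite ltn_mod; lia.
move: yE; set l := (y %/ _)%N; set r := (y %% _)%N => yE rkk.
have [rk|kr] := ltnP r k; first by exists r; split=> //; left.
by exists (r - k)%N; split; [lia | right; rewrite /jobB; lia].
Qed.

(** Serves acyclicity: labels cannot increase strictly around a cycle. *)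
Lemma arc_ltn (k : nat) (f : nat -> nat) (x y : nat) :
  (0 < k)%N -> (forall l, f l < k)%N -> arc k f x y -> (x < y)%N.
Proof.
move=> k0 fk; have [l [j [jk [->|->]]]] := job_split y k0.
  rewrite arc_jobA //; case: l => [//|l] /= /eqP ->.
  by rewrite /jobA /jobB; have := fk l; lia.
by rewrite arc_jobB // => /eqP ->; rewrite /jobA /jobB; lia.
Qed.

(** A hub index shows only in the arcs into the next layer, so the adversary may fix the hub of
    layer [L] without altering the layers up to [L]. *)
Lemma arc_eq_in (k L : nat) (f f' : nat -> nat) (x y : nat) :
  (0 < k)%N -> (forall l, (l < L)%N -> f' l = f l) -> (y < L.+1 * (k + k))%N ->
  arc k f' x y = arc k f x y.
Proof.
move=> k0 ff'; have [l [j [jk [->|->]]]] := job_split y k0.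
  by rewrite jobA_lt // !arc_jobA //; case: l => [//|l] /= lL; rewrite ff'.
by rewrite !arc_jobB.
Qed.

Lemma tree_wf {R : realType} (k : nat) (f : nat -> nat) (L : nat) :
  (0 < k)%N -> (forall l, f l < k)%N -> wf_instance (@tree R k f L).
Proof.
move=> k0 fk; split=> //=; first exact: iota_uniq.
  move=> x y /andP[yL /arc_ltn xy]; rewrite !mem_iota /= !add0n yL.
  by split=> //; exact: ltn_trans (xy k0 fk) yL.
case=> x [p [p0 [xp pE]]].
have: path ltn x p.
  by apply: sub_path xp => a b /andP[_ ab]; exact: arc_ltn ab.
rewrite path_sortedE; last exact: ltn_trans.
case/andP=> /allP/(_ (last x p)) xlast _.
have: last x p \in p by case: (p) p0 => //= a s _; exact: mem_last.
by move=> /xlast; rewrite pE /= ltnn.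
Qed.

(** Transfers the capacity bound from all jobs to the jobs A of one layer, whose labels are
    consecutive. *)
Lemma sum_segment_le {R : numDomainType} (F : nat -> R) (m k N : nat) :
  (forall j, 0 <= F j) -> (m + k <= N)%N ->
  \sum_(0 <= j < k) F (m + j)%N <= \sum_(j <- iota 0 N) F j.
Proof.
move=> F0 mkN; have -> : iota 0 N = index_iota 0 N by rewrite /index_iota subn0.
rewrite [leRHS](big_cat_nat (leq0n m)) /=; last by lia.
rewrite [X in _ <= _ + X](big_cat_nat (leq_addr k m)) //=.
rewrite [X in _ <= _ + (X + _)](_ : _ = \sum_(0 <= j < k) F (m + j)%N).
  have S0 a b : 0 <= \sum_(a <= j < b) F j by apply: sumr_ge0.
  by rewrite ler_wpDl // lerDl.
rewrite -{1}[m]add0n big_addn addnC addnK.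
by apply: eq_bigr => j _; rewrite addnC.
Qed.

(** * The adversary *)

(** Completing all q^2 unit jobs takes work q^2, but total speed at most q for a time shorter than q
    yields less. *)
Lemma unfinished_job {R : realType} (q L : nat) (f : nat -> nat)
    (S : @schedule R) (tau t : R) :
  let k := (q * q)%N in
  (0 < q)%N -> 0 <= tau -> tau <= t -> t - tau < q%:R ->
  feasible 2^-1 (tree k f L.+1) S ->
  (forall x j, 0 < x <= tau -> (j < k)%N -> S x (jobA k L j) = 0) ->
  exists2 j, (j < k)%N & (processed 2^-1 S (jobA k L j) t < 1%:E)%E.
Proof.
move=> k q0 tau0 taut ttau [mS S01 [_ S1] _ _] idle.
apply: contrapT => all_done.
have done1 j : (j < k)%N -> (1%:E <= processed 2^-1 S (jobA k L j) t)%E.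
  by move=> jk; rewrite leNgt; apply/negP => lt1; apply: all_done; exists j.
have := @sum_processed_le R q S (jobA k L) tau t q0 tau0 taut mS.
rewrite leNgt => /(_ _ _ _)/negP; apply.
- by move=> x j x0; have [] := S01 x j x0.
- move=> x x0; apply: le_trans (S1 _ x0); apply: (sum_segment_le (F := S x)).
    by move=> j; have [] := S01 x j x0.
  by rewrite /k; lia.
- by move=> x j jk xtau; exact: idle.
apply: (@lt_le_trans _ _ (\sum_(0 <= j < k) 1%:E)%E).
  rewrite sumEFin lte_fin sumr_const_nat subn0 natrM ltr_pM2l //.
  by rewrite ltr0n.
by rewrite !big_mkord; apply: lee_sum => j _; exact: done1.
Qed.

(** Induction on the number of layers: a job A of layer [L] unfinished [q / 2] later determines the
    hub, and a new layer is hung below it. Up to that time the run cannot distinguish the two trees,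
    hence ignores the new jobs A. *)
Lemma adversary {R : realType} (ALG : @instance R -> @schedule R) (q L : nat) :
  online_algorithm 2^-1 ALG -> (0 < q)%N ->
  exists2 f : nat -> nat, (forall l, f l < q * q)%N &
    forall t j, 0 < t <= L%:R * (q%:R / 2) -> (j < q * q)%N ->
      ALG (tree (q * q) f L.+1) t (jobA (q * q) L j) = 0.
Proof.
move=> [feas nonant] q0; set k := (q * q)%N.
have k0 : (0 < k)%N by rewrite /k; lia.
elim: L => [|L [f fk idle]].
  exists (fun=> 0%N) => // t j /andP[t0]; rewrite mul0r.
  by move=> /(lt_le_trans t0); rewrite ltxx.
set I := @tree R k f L.+1; set tau := L%:R * (q%:R / 2) in idle.
set t := L.+1%:R * (q%:R / 2).
have qR : 0 < q%:R :> R by rewrite ltr0n.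
have tau0 : 0 <= tau by rewrite mulr_ge0 // divr_ge0.
have tE : t = tau + q%:R / 2 by rewrite /t -natr1 mulrDl mul1r.
have taut : tau <= t by lra.
have ttau : t - tau < q%:R by lra.
have t0 : 0 <= t by lra.
have wfI : wf_instance I by exact: tree_wf.
have feasI := feas _ wfI.
have [h hk h_unfinished] := unfinished_job q0 tau0 taut ttau feasI idle.
have [mS S01 [offI _] precI _] := feasI.
have processed_off s j : (L.+1 * (k + k) <= j)%N ->
    processed 2^-1 (ALG I) j s = 0%E.
  move=> jI; apply: processed_idle => // x /andP[x0 _]; apply: offI => //.
  by rewrite mem_iota /= add0n -leqNgt.
(* The future hub has not started by time [t], because its predecessor is unfinished then. *)
have processed_hub s : s <= t -> processed 2^-1 (ALG I) (jobB k L h) s = 0%E.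
  move=> st; apply: processed_idle => // x /andP[x0 xs].
  have [hub0 _] := S01 x (jobB k L h) x0.
  move: hub0; rewrite le_eqVlt => /orP[/eqP //|hub0].
  have Ehub : inst_E I (jobA k L h) (jobB k L h).
    by rewrite /= jobB_lt // ltnSn arc_jobB //=.
  have := precI _ _ _ Ehub x0 hub0; rewrite leNgt => /negP[].
  apply: le_lt_trans h_unfinished.
  by apply: processed_mono => //; exact: le_trans xs st.
pose f' l := if l == L then h else f l.
have f'L : f' L = h by rewrite /f' eqxx.
have f'f l : (l < L)%N -> f' l = f l by move=> lL; rewrite /f' ltn_eqF.
have f'k l : (f' l < k)%N by rewrite /f'; case: ifP.
exists f' => //; set I' := @tree R k f' L.+2.
have wfI' : wf_instance I' by exact: tree_wf.
have memI y : (y \in inst_J I) = (y < L.+1 * (k + k))%N by rewrite mem_iota.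
have memI' y : (y \in inst_J I') = (y < L.+2 * (k + k))%N by rewrite mem_iota.
have II' y : (y < L.+1 * (k + k))%N -> (y < L.+2 * (k + k))%N by lia.
have EE' x y : (y < L.+1 * (k + k))%N -> inst_E I' x y = inst_E I x y.
  move=> yI; rewrite /= yI II' //=; exact: (arc_eq_in x k0 f'f yI).
(* Each new job has a predecessor with no work done by time [t] in the run on [I]: the hub, or a job
   outside [I]. Hence no new job becomes available. *)
have new_layer y : (L.+1 * (k + k) <= y)%N -> (y < L.+2 * (k + k))%N ->
    exists2 x, inst_E I' x y & x = jobB k L h \/ (L.+1 * (k + k) <= x)%N.
  have [l [j [jk [->|->]]]] := job_split y k0.
  - rewrite leqNgt !jobA_lt // => Ll lL2; have {Ll lL2}-> : l = L.+1 by lia.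
    exists (jobB k L h); last by left.
    by rewrite /= jobA_lt // ltnSn arc_jobA //= f'L.
  - rewrite leqNgt !jobB_lt // => Ll lL2; have {Ll lL2}-> : l = L.+1 by lia.
    exists (jobA k L.+1 j); last by right; rewrite leqNgt jobA_lt // ltnn.
    by rewrite /= jobB_lt // ltnSn arc_jobB //=.
have same_run : forall t' j, 0 < t' <= t -> ALG I t' j = ALG I' t' j.
  apply: nonant => //.
  - move=> s j /andP[_ st]; rewrite /available memI memI'.
    split=> -[jI pj]; first by split=> [|i]; rewrite ?II' // EE' //; exact: pj.
    have [jI0|Ij] := ltnP j (L.+1 * (k + k)).
      by split=> // i Eij; apply: pj; rewrite EE'.
    have [x Exj xE] := new_layer _ Ij jI; have := pj x Exj.
    case: xE => [->|Ix]; first by rewrite processed_hub // lee_fin ler10.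
    by rewrite processed_off // lee_fin ler10.
  - move=> j [jI pj]; split=> // y.
    move: jI; rewrite memI => jI.
    have [yI|Iy] := ltnP y (L.+1 * (k + k)); first by rewrite EE' //= yI.
    rewrite /= [in LHS]ltnNge Iy /=; apply/esym/negP => /andP[yI'].
    (* Only the hub has arcs from the old layers into the new one, and it is not yet revealed at
       time [t]. *)
    have [l [i [ik [yE|yE]]]] := job_split y k0.
    + move: Iy yI'; rewrite yE leqNgt !jobA_lt // => Ll lL2.
      have {Ll lL2}-> : l = L.+1 by lia.
      rewrite arc_jobA //= f'L => /eqP jE.
      have := pj (jobA k L h); rewrite jE /= jobB_lt // ltnSn arc_jobB // eqxx.
      by move=> /(_ isT); rewrite leNgt h_unfinished.
    + move: Iy yI'; rewrite yE leqNgt !jobB_lt // => Ll lL2.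
      have {Ll lL2}-> : l = L.+1 by lia.
      by rewrite arc_jobB //= => /eqP jE; move: jI; rewrite jE jobA_lt // ltnn.
move=> s j /andP[s0 st] jk; rewrite -same_run ?s0 //.
by apply: offI => //; rewrite mem_iota /= add0n jobA_lt // ltnn.
Qed.

(** * The offline schedule *)

Lemma opt_tree_le {R : realType} (k : nat) (f : nat -> nat) :
  (0 < k)%N -> (forall l, f l < k)%N ->
  (opt_makespan 2^-1 (@tree R k f k) <= (6 * k%:R)%:E)%E.
Proof.
move=> k0 fk; set I := tree k f k; pose K := (k + k)%N; have KE : K = (k + k)%N by [].
have K0 : (0 < K)%N by rewrite /K; lia.
have KR : 0 < K%:R :> R by rewrite ltr0n.
(* The hub path alternates A and B. It takes [K] unit phases; phases [K] and [K.+1], of length [K]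
   each, run all A and then all B, ending at 3K = 6k. Hub jobs are run a second time, which is
   harmless. *)
pose hub p := if odd p then jobB k p./2 (f p./2) else jobA k p./2 (f p./2).
pose u p : R := (if (p <= K)%N then p else K + (p - K) * K)%N%:R.
pose stage p j := (j < k * K)%N && ((p == K) == (j %% K < k)%N).
(* A share of 1/K^2 gives speed 1/K, so a unit job fills a phase of length [K] exactly. *)
pose w p j : R := if (p < K)%N then (j == hub p)%:R
                  else (stage p j)%:R * (K%:R^-1 ^+ 2).
have u_early p : (p < K)%N -> u p.+1 - u p = 1.
  by move=> pK; rewrite /u pK (ltnW pK) -natr1 addrC addKr.
have u_late p : (K <= p)%N -> u p.+1 - u p = K%:R.
  move=> Kp; rewrite /u ltnNge Kp /= subSn // mulSn.
  have -> : (if (p <= K)%N then p else (K + (p - K) * K)%N) = (K + (p - K) * K)%N.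
    by case: ifP => // pK; have -> : p = K by [lia]; rewrite subnn mul0n addn0.
  by rewrite natrD addrK.
have uS p : u p <= u p.+1.
  by rewrite -subr_ge0; case: (ltnP p K) => pK; [rewrite u_early | rewrite u_late].
have w0 p j : 0 <= w p j.
  by rewrite /w; case: ifP => _ //; rewrite mulr_ge0 // exprn_ge0 // invr_ge0.
have hub_lt p : (p < K)%N -> (hub p < k * K)%N.
  move=> pK; rewrite /hub.
  by case: ifP => _; [rewrite jobB_lt | rewrite jobA_lt] => //; lia.
have fin_early p : (p < K)%N -> 1 <= pw 2^-1 (w p (hub p)) * (u p.+1 - u p).
  by move=> pK; rewrite u_early // /w pK eqxx /pw powR1 mulr1.
have fin_late p j : (K <= p)%N -> stage p j ->
    1 <= pw 2^-1 (w p j) * (u p.+1 - u p).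
  move=> Kp pj; rewrite u_late // /w ltnNge Kp /= pj mul1r /pw powR12_sqrt; last first.
    by rewrite exprn_ge0 // invr_ge0.
  by rewrite sqrtr_sqr ger0_norm ?invr_ge0 // mulVf ?gt_eqF.
have modA l j : (j < k)%N -> (jobA k l j %% K < k)%N.
  by move=> jk; rewrite /jobA modnMDl modn_small // /K; lia.
have modB l j : (j < k)%N -> (jobB k l j %% K < k)%N = false.
  by move=> jk; rewrite /jobB modnMDl modn_small /K; lia.
have feasible_phased : feasible 2^-1 I (phased u w K.+2).
  apply: phased_feasible => //.
  - by move=> p j; rewrite mem_iota /= add0n => /negbTE jI; rewrite /w /stage jI
      mul0r; case: ifP => // pK; case: eqP => // jh; rewrite jh hub_lt in jI.
  - move=> p _; rewrite /w /=; case: (ltnP p K) => pK.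
      rewrite -natr_sum ler_nat.
      rewrite -(@big_mkcond _ _ addn _ _ (pred1 (hub p)) (fun=> 1%N)) sum1_count.
      by rewrite count_uniq_mem ?iota_uniq // leq_b1.
    (* Counting all [k * K] jobs, not just one kind, still gives a total of k/K, below 1. *)
    apply: (@le_trans _ _ (\sum_(j <- iota 0 (k * K)) K%:R^-1 ^+ 2)).
      by apply: ler_sum => j _; rewrite ler_piMl ?exprn_ge0 ?invr_ge0 // lern1 leq_b1.
    rewrite big_const_seq count_predT size_iota iter_addr addr0 -[leLHS]mulr_natr natrM.
    have -> : K%:R^-1 ^+ 2 * (k%:R * K%:R) = k%:R / K%:R :> R.
      by field; rewrite gt_eqF.
    by rewrite ler_pdivrMr // mul1r ler_nat /K leq_addr.
  - move=> i j p /= /andP[jN Eij] pK2; rewrite {1}/w.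
    case: ltnP => [pK|Kp].
      case: eqP => [jh _|_]; last by rewrite ltxx.
      have [l pE] : exists l, p = l.*2 \/ p = l.*2.+1.
        by exists p./2; lia.
      (* On the hub path, the only predecessor of a job is the job just before it. *)
      have p1 : (0 < p)%N /\ i = hub p.-1.
        move: Eij; rewrite jh; case: pE => ->; rewrite /hub /=.
          rewrite odd_double doubleK arc_jobA //; case: l => [//|l] /= /eqP ->.
          by rewrite odd_double /= uphalf_double.
        by rewrite odd_double /= uphalf_double doubleK arc_jobB // => /eqP ->.
      case: p1 => p1 ->; exists p.-1; first by rewrite prednK.
      by apply: fin_early; lia.
    case: (boolP (stage p j)) => [/andP[_ pj] _|_]; last by rewrite mul0r ltxx.
    have [l [h [hk [jE|jE]]]] := job_split j k0; move: pj jN Eij; rewrite jE.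
    - rewrite modA // jobA_lt // arc_jobA // => /eqP pK lk /andP[l0 /eqP ->].
      have iE : jobB k l.-1 (f l.-1) = hub l.-1.*2.+1.
        by rewrite /hub /= odd_double /= uphalf_double.
      exists l.-1.*2.+1; first by lia.
      by rewrite iE; apply: fin_early; rewrite /K; lia.
    - rewrite modB // jobB_lt // arc_jobB // => /eqP pK lk /eqP ->.
      exists K; first by lia.
      by apply: fin_late => //; rewrite /stage eqxx modA // jobA_lt // lk.
  - move=> j; rewrite mem_iota /= add0n => jN.
    have [jA|jB] := boolP (j %% K < k)%N.
      by exists K => //; apply: fin_late => //; rewrite /stage jN eqxx jA.
    exists K.+1 => //; apply: fin_late => //.
    by rewrite /stage jN (negbTE jB) gtn_eqF.
apply: (@le_trans _ _ (makespan I (phased u w K.+2))).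
  by apply: ereal_inf_lbound; exists (phased u w K.+2).
apply: le_trans (phased_makespan I K.+2 uS w0) _.
rewrite lee_fin /u ifF; last by lia.
rewrite -[6]/(6%:R) -natrM ler_nat /K; lia.
Qed.

(** * The lower bound on the competitive ratio *)

(** Some job A of the last layer must receive machines at some time, and the adversary keeps that
    layer idle for [(q * q).-1] delays of [q / 2]. *)
Lemma online_tree_gt {R : realType} (ALG : @instance R -> @schedule R) (q : nat) :
  online_algorithm 2^-1 ALG -> (0 < q)%N ->
  exists2 f : nat -> nat, (forall l, f l < q * q)%N &
    (((q * q).-1%:R * (q%:R / 2))%:E <
     makespan (tree (q * q) f (q * q)) (ALG (tree (q * q) f (q * q))))%E.
Proof.
move=> onl q0; have [f fk] := adversary (q * q).-1 onl q0.
have k0 : (0 < q * q)%N by lia.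
rewrite prednK //; set k := (q * q)%N => idle; exists f => //.
set I := tree k f k; have [_ S01 [offI _] _ finI] := onl.1 I (tree_wf k k0 fk).
have jI : jobA k k.-1 0 \in inst_J I by rewrite mem_iota /= jobA_lt // prednK.
have [t t0 St] : exists2 t : R, 0 < t & ALG I t (jobA k k.-1 0) != 0.
  apply: (@processed_total_gt0 _ 2^-1) => //.
  by apply: lt_le_trans (finI _ jI); rewrite lte_fin.
apply: (@lt_le_trans _ _ t%:E).
  rewrite lte_fin ltNge; apply/negP => tle.
  by move/eqP: St; apply; apply: idle; rewrite ?t0.
apply: ereal_sup_ubound; exists t => //; split=> //.
have S0 j : 0 <= ALG I t j by have [] := S01 t j t0.
rewrite (big_rem _ jI) /= ltr_pwDl ?sumr_ge0 //.
by rewrite lt_neqAle eq_sym St S0.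
Qed.

(* There is a fixed power function p(z) = z^gamma (0 < gamma < 1) such that
   every online algorithm for GPS restricted to instances whose processing
   functions all equal p has a competitive ratio that is not sub-polynomial
   in the number n of jobs: for some eps > 0, the ratio ALG/OPT exceeds
   C * n^eps on some instance, for every constant C > 0. *)
Theorem theorem3 (R : realType) :
  exists gamma : R, 0 < gamma < 1 /\
  forall ALG : @instance R -> @schedule R,
    online_algorithm gamma ALG ->
    exists eps : R, 0 < eps /\
    forall C : R, 0 < C ->
      exists I : @instance R, wf_instance I /\
        (makespan I (ALG I) >
         (C * ((size (inst_J I))%:R `^ eps))%:E * opt_makespan gamma I)%E.
Proof.
exists 2^-1; split; first by lra.
(* With q = r^2 there are n = 2 r^8 jobs, so n^(1/8) is at most 2r, while the ratio is at least
   (k/2)(q/2)/(6k) = r^2/24. Hence r > 48 C suffices. *)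
move=> ALG onl; exists (8%:R^-1); split; first by rewrite invr_gt0.
(* The offset 2 forces [k] to be at least 2, so that [k.-1] is at least k/2. *)
move=> C C0; pose r := (Num.bound (48 * C)).+2; pose q := (r * r)%N.
have rC : 48 * C < r%:R.
  have C48 : 0 <= 48 * C by lra.
  by apply: lt_trans (archi_boundP C48) _; rewrite ltr_nat /r; lia.
have r2 : (2 <= r)%N by [].
have q0 : (0 < q)%N by rewrite /q; lia.
have [f fk ALG_gt] := online_tree_gt onl q0.
set k := (q * q)%N in fk ALG_gt; have k0 : (0 < k)%N by rewrite /k; lia.
exists (tree k f k); split; first exact: tree_wf.
apply: le_lt_trans ALG_gt.
have -> : size (inst_J (@tree R k f k)) = (k * (k + k))%N by rewrite size_iota.
have root_le : (k * (k + k))%:R `^ 8%:R^-1 <= 2 * r%:R :> R.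
  have -> : 2 * r%:R = ((2 * r%:R) ^+ 8) `^ 8%:R^-1 :> R.
    by rewrite -powR_mulrn ?mulr_ge0 // -powRrM mulfV ?powRr1 ?mulr_ge0 // pnatr_eq0.
  apply: ge0_ler_powR; rewrite ?nnegrE ?invr_ge0 ?exprn_ge0 ?mulr_ge0 //.
  rewrite -natrM -natrX ler_nat expnMn /k /q.
  have -> : (r * r * (r * r) * (r * r * (r * r) + r * r * (r * r)) = 2 * r ^ 8)%N.
    by rewrite !expnS expn0; lia.
  by rewrite leq_mul2r; apply/orP; right.
have bound_ge0 : 0 <= C * (k * (k + k))%:R `^ 8%:R^-1.
  by rewrite mulr_ge0 ?powR_ge0 // ltW.
apply: (@le_trans _ _ ((C * (k * (k + k))%:R `^ 8%:R^-1)%:E * (6 * k%:R)%:E)%E).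
  by apply: lee_wpmul2l; rewrite ?lee_fin //; exact: opt_tree_le.
rewrite -EFinM lee_fin.
have kR : 2 <= k%:R :> R by rewrite ler_nat /k /q; nia.
have k1R : k%:R / 2 <= k.-1%:R :> R by rewrite -subn1 natrB //; lra.
apply: (@le_trans _ _ (C * (2 * r%:R) * (6 * k%:R))).
  by rewrite ler_wpM2r ?mulr_ge0 // ler_wpM2l // ltW.
apply: (@le_trans _ _ (k%:R / 2 * (q%:R / 2))).
  have -> : C * (2 * r%:R) * (6 * k%:R) = 48 * C * (r%:R * k%:R / 4) by field.
  have -> : k%:R / 2 * (q%:R / 2) = r%:R * (r%:R * k%:R / 4) :> R.
    by rewrite /q natrM; field.
  by rewrite ler_wpM2r ?divr_ge0 ?mulr_ge0 // ltW.
by rewrite ler_wpM2r // divr_ge0.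
Qed.
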